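(* Let $k=3$ and let $A_n$, $\bar A_n$ be the antiregular $3$-hypergraphs defined in the context. Then for every integer $n\geq 1$, $$I(A_{2n-1};x)=3(1+x)^n+(1+x)^{n-1}-2nx-3,\qquad I(\bar A_{2n};x)=3(1+x)^{n+1}+(1+x)^n-(1+x)(2nx+3),$$ and $$I(\bar A_{2n-1};x)=(1+x)^{n+1}+3(1+x)^n-(1+x)\big((2n-1)x+3\big),\qquad I(A_{2n};x)=(1+x)^{n+1}+3(1+x)^n-(2n+1)x-3.$$
   Context: Here $k=3$ and all hypergraphs are $3$-uniform (every hyperedge has exactly $3$ vertices). For a binary string $b=b_1\cdots b_n$, let $H(b)$ be the $3$-uniform hypergraph on $\{1,\dots,n\}$ in which a $3$-subset is a hyperedge iff its largest element $j$ satisfies $b_j=1$ (i.e., vertices are added in order, vertex $j$ as an isolated vertex if $b_j=0$ and as a dominating vertex, joined in a hyperedge with every $2$-subset of earlier vertices, if $b_j=1$). For $n\le 2$, $A_n=\bar A_n$ is the edgeless hypergraph on $n$ vertices. For $n\geq 3$, $A_n=H(b)$ where $b$ has length $n$, $b_1=b_2=0$, the bits $b_3,\dots,b_n$ alternate, and $b_n=1$; $\bar A_n$ is the same with $b_n=0$. A vertex set is independent if it contains no hyperedge, and $I(H;x)=\sum_{W\text{ independent}}x^{|W|}$. *)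

(* Defs.v *)
From HB Require Import structures.
From mathcomp Require Import all_boot all_order all_algebra.

Set Implicit Arguments.
Unset Strict Implicit.
Unset Printing Implicit Defensive.

Import GRing.Theory.
Local Open Scope ring_scope.

(* A hypergraph on the vertex type T is given by its set of hyperedges. *)
Definition hypergraph (T : finType) : Type := {set {set T}}.

Definition independent (T : finType) (H : hypergraph T) (W : {set T}) : bool :=
  [forall e in H, ~~ (e \subset W)].

Definition indep_poly (T : finType) (H : hypergraph T) : {poly int} :=
  \sum_(W : {set T} | independent H W) 'X^#|W|.

(* Vertices and bits are numbered from 0: the vertex j of {1, ..., n} is the
   element j - 1 of 'I_n, and b_j is the entry j - 1 of the tuple. *)
Definition string_hypergraph (n : nat) (b : n.-tuple bool) : hypergraph 'I_n :=
  [set e : {set 'I_n} | (#|e| == 3)%N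
     && [exists j in e, [forall i in e, (i <= j)%N] && tnth b j]].

(* b_1 = b_2 = 0, the bits b_3, ..., b_n alternate, and b_n = c. *)
Definition alternating_string (n : nat) (c : bool) (b : n.-tuple bool) : Prop :=
  [/\ forall i : 'I_n, (i < 2)%N -> tnth b i = false,
      forall i j : 'I_n, (2 <= i)%N -> j = i.+1 :> nat ->
        tnth b j = ~~ tnth b i
    & forall i : 'I_n, i.+1 = n -> tnth b i = c].

(* A bit with index at least 2 is c when its distance to the last index is
   even, and ~~ c otherwise. *)
Definition antiregular_string (n : nat) (c : bool) : n.-tuple bool :=
  [tuple (2 <= i)%N && (c (+) odd (n - i.+1)) | i < n].

Lemma alternating_stringP (n : nat) (c : bool) (b : n.-tuple bool) :
  (3 <= n)%N -> alternating_string c b <-> b = antiregular_string n c.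
Proof.
move=> n3; split=> [[b0 balt blast]|->]; last first.
  split=> [i i2|i j i2 ji|i ni]; rewrite !tnth_mktuple.
  - by rewrite leqNgt i2.
  - have jn : (i.+1 < n)%N by rewrite -ji.
    by rewrite ji i2 (leqW i2) /= -(subnSK jn) /= addbN negbK.
  - by rewrite ni subnn addbF andb_idl // => _; rewrite -ltnS ni.
apply: eq_from_tnth => i; rewrite tnth_mktuple.
have [i2|i2] /= := leqP 2 i; last exact: b0.
move Ed: (n - i.+1)%N => d; elim: d i i2 Ed => [|d IHd] i i2 Ed.
  rewrite addbF; apply: blast; apply/eqP; rewrite eqn_leq ltn_ord /=.
  by rewrite -subn_eq0 Ed.
have ltin : (i.+1 < n)%N by rewrite -subn_gt0 Ed.
have /(congr1 negb) := balt i (Ordinal ltin) i2 erefl.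
rewrite negbK => <-; rewrite IHd /= ?addbN //; first exact: leqW.
by rewrite subnS Ed.
Qed.

(* antiregular n true is A_n, and antiregular n false is \bar A_n. *)
Definition antiregular (n : nat) (c : bool) : hypergraph 'I_n :=
  if (n <= 2)%N then set0 else string_hypergraph (antiregular_string n c).

Definition A (n : nat) : hypergraph 'I_n := antiregular n true.
Definition Abar (n : nat) : hypergraph 'I_n := antiregular n false.

(* Main.v *)
Require Import Defs.
From HB Require Import structures.
From mathcomp Require Import all_boot all_order all_algebra.
From mathcomp Require Import ring.

Import GRing.Theory.
Local Open Scope ring_scope.

(* Appending an isolated vertex multiplies the independence polynomial by
   1 + x.  After appending a dominating vertex to m vertices, the independent
   sets containing it are those of size at most 2, which adds x + m x^2.  No
   hyperedge sees the first two bits, so A_(m+1) is Abar_m plus a dominating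
   vertex and Abar_(m+1) is A_m plus an isolated one for every m >= 0, and the
   four formulas follow by a simultaneous induction starting from m = 0. *)

(** A hyperedge is a vertex with bit 1 together with two distinct earlier vertices. Trading
    hyperedges for such triples gives a criterion that transports along [lift ord_max]. *)
Lemma string_independentP (n : nat) (b : n.-tuple bool) (W : {set 'I_n}) :
  reflect (forall i k j, i \in W -> k \in W -> j \in W ->
             i != k -> (i < j)%N -> (k < j)%N -> ~~ tnth b j)
          (independent (string_hypergraph b) W).
Proof.
apply: (iffP forall_inP) => [indW i k j iW kW jW neq_ik lt_ij lt_kj | indW e].
  apply/negP => bj.
  have neq_ij : i != j by rewrite -val_eqE /= ltn_eqF.
  have neq_kj : k != j by rewrite -val_eqE /= ltn_eqF.
  have /negP[] : ~~ ([set i; k; j] \subset W).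
    apply: indW; rewrite inE; apply/andP; split.
      by rewrite -setUA cardsU1 cards2 neq_kj !inE negb_or neq_ik neq_ij.
    apply/exists_inP; exists j; first by rewrite !inE eqxx orbT.
    rewrite bj andbT; apply/forall_inP => l; rewrite !inE.
    by case/orP => [/orP[]|] /eqP -> //; exact: ltnW.
  by apply/subsetP => l; rewrite !inE => /orP[/orP[]|] /eqP ->.
rewrite inE => /andP[card_e /exists_inP[j je /andP[/forall_inP max_j bj]]].
(* Removing the largest vertex [j] from [e] leaves a pair, which supplies [i] and [k]. *)
have card_ej : #|e :\ j| == 2%N.
  by rewrite -eqSS -(eqP card_e) (cardsD1 j e) je.
have [i [k [neq_ik def_e]]] := cards2P _ card_ej.
have lt_j l : l \in e :\ j -> (l \in e) && (l < j)%N.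
  by rewrite 2!inE => /andP[neq_lj le]; rewrite le ltn_neqAle neq_lj max_j.
have /andP[ie lt_ij] : (i \in e) && (i < j)%N by rewrite lt_j // def_e set21.
have /andP[ke lt_kj] : (k \in e) && (k < j)%N by rewrite lt_j // def_e set22.
apply/negP => /subsetP sub_eW; move: bj; apply/negP.
by apply: (indW i k j) => //; exact: sub_eW.
Qed.

Lemma string_independent_small (n : nat) (b : n.-tuple bool) (W : {set 'I_n}) :
  (#|W| <= 2)%N -> independent (string_hypergraph b) W.
Proof.
move=> small_W; apply/forall_inP => e; rewrite inE => /andP[/eqP card_e _].
by apply/negP => /subset_leq_card; rewrite card_e leqNgt ltnS small_W.
Qed.

(** A bit is consulted only at the largest element of a 3-set, and two smaller elements force its
    index to be at least 2. *)
Lemma eq_string_hypergraph (n : nat) (b b' : n.-tuple bool) :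
  (forall i : 'I_n, (2 <= i)%N -> tnth b i = tnth b' i) ->
  string_hypergraph b = string_hypergraph b'.
Proof.
move=> eq_bb'; apply/setP => e; rewrite !inE.
have [card_e|//] := eqVneq #|e| 3; rewrite !andTb.
apply: eq_existsb => j.
have [je|//] := boolP (j \in e); rewrite !andTb.
have [/forall_inP max_j|//] := boolP [forall i in e, (i <= j)%N].
rewrite !andTb.
(* As [j] is the maximum of [e], the set [e] embeds into ['I_j.+1]; comparing cardinalities gives 3
   <= j + 1. *)
have inj_inord : {in e &, injective (fun i : 'I_n => inord i : 'I_j.+1)}.
  move=> i k ie ke /(congr1 val) /=; rewrite !inordK ?ltnS ?max_j //.
  exact: val_inj.
apply: eq_bb'; rewrite -ltnS -[2.+1]card_e -(card_in_imset inj_inord).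
by rewrite -[leqRHS]card_ord max_card.
Qed.

Lemma tnth_rcons_lift (n : nat) (b : n.-tuple bool) (c : bool) (i : 'I_n) :
  tnth [tuple of rcons b c] (lift ord_max i) = tnth b i.
Proof.
by rewrite !(tnth_nth false) lift_max /= nth_rcons size_tuple ltn_ord.
Qed.

Lemma tnth_rcons_max (n : nat) (b : n.-tuple bool) (c : bool) :
  tnth [tuple of rcons b c] ord_max = c.
Proof. by rewrite (tnth_nth false) /= nth_rcons size_tuple ltnn eqxx. Qed.

(** [lift ord_max] keeps the index and the bit of every old vertex, and [c] is never read because
    the new vertex [ord_max] is outside the set. *)
Lemma string_independent_lift (n : nat) (b : n.-tuple bool) (c : bool)
    (W : {set 'I_n}) :
  independent (string_hypergraph [tuple of rcons b c]) (lift ord_max @: W) =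
  independent (string_hypergraph b) W.
Proof.
have mem_lift i : (lift ord_max i \in lift ord_max @: W) = (i \in W).
  exact/mem_imset/lift_inj.
apply/string_independentP/string_independentP => indW.
  move=> i k j iW kW jW neq_ik lt_ij lt_kj.
  rewrite -(tnth_rcons_lift n b c j).
  apply: (indW (lift ord_max i) (lift ord_max k)); rewrite ?mem_lift //.
  - by rewrite (inj_eq lift_inj).
  - by rewrite !lift_max.
  - by rewrite !lift_max.
move=> _ _ _ /imsetP[i iW ->] /imsetP[k kW ->] /imsetP[j jW ->].
rewrite (inj_eq lift_inj) !lift_max tnth_rcons_lift; exact: indW.
Qed.

(** A dominating new vertex forms a hyperedge with any two elements of [W]. An isolated one lies in
    no hyperedge: its own bit is 0 and it is below no other vertex. *)
Lemma string_independent_max (n : nat) (b : n.-tuple bool) (c : bool)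
    (W : {set 'I_n}) :
  independent (string_hypergraph [tuple of rcons b c])
    (ord_max |: lift ord_max @: W) =
  if c then (#|W| <= 1)%N else independent (string_hypergraph b) W.
Proof.
have max_notin : ord_max \notin lift ord_max @: W.
  by apply/negP => /imsetP[i _ /eqP]; rewrite (negbTE (neq_lift _ _)).
case: c => [|]; last first.
  rewrite -(string_independent_lift n b false).
  apply/string_independentP/string_independentP => indW i k j iW kW.
    by move=> jW; apply: indW; rewrite // inE ?iW ?kW ?jW orbT.
  case/setU1P => [->|jW]; first by rewrite tnth_rcons_max.
  move=> neq_ik lt_ij lt_kj.
  (* An element below [j] cannot be [ord_max], so it comes from [W]. *)
  have in_lift (l : 'I_n.+1) : (l < j)%N ->
      l \in ord_max |: lift ord_max @: W -> l \in lift ord_max @: W.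
    move=> lt_lj /setU1P[eq_l|//].
    by rewrite eq_l ltnNge -ltnS ltn_ord in lt_lj.
  by apply: (indW i k j) => //; exact: in_lift.
apply/idP/idP => [/string_independentP indW|small_W]; last first.
  apply: string_independent_small.
  by rewrite cardsU1 max_notin card_imset //; exact: lift_inj.
rewrite leqNgt; apply/negP => /card_gt1P[i [k [iW kW neq_ik]]].
have := indW (lift ord_max i) (lift ord_max k) ord_max.
rewrite tnth_rcons_max (inj_eq lift_inj) !lift_max !ltn_ord !inE eqxx.
rewrite !(mem_imset _ _ lift_inj) iW kW !orbT.
by move/(_ isT isT isT neq_ik isT isT).
Qed.

(** The sets are split by whether they contain [ord_max]; in both classes the preimage under
    [lift ord_max] inverts the parametrization by subsets of ['I_n]. *)
Lemma big_set_ord_recr (R : nmodType) (n : nat) (P : pred {set 'I_n.+1})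
    (F : {set 'I_n.+1} -> R) :
  \sum_(W | P W) F W =
  \sum_(W : {set 'I_n} | P (lift ord_max @: W)) F (lift ord_max @: W) +
  \sum_(W : {set 'I_n} | P (ord_max |: lift ord_max @: W))
     F (ord_max |: lift ord_max @: W).
Proof.
have max_notin (W : {set 'I_n}) : ord_max \notin lift ord_max @: W.
  by apply/negP => /imsetP[i _ /eqP]; rewrite (negbTE (neq_lift _ _)).
have imsetK : cancel (fun W : {set 'I_n} => lift ord_max @: W)
                     (fun W => lift ord_max @^-1: W).
  by move=> W; apply/setP => i; rewrite inE (mem_imset _ _ lift_inj).
have setU1K (W : {set 'I_n}) :
    lift ord_max @^-1: (ord_max |: lift ord_max @: W) = W.
  apply/setP => i.
  by rewrite !inE eq_sym (negbTE (neq_lift _ _)) (mem_imset _ _ lift_inj).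
have preimsetK (W : {set 'I_n.+1}) :
    lift ord_max @: (lift ord_max @^-1: W) = W :\ ord_max.
  apply/setP => i; rewrite !inE.
  case: (unliftP ord_max i) => [k|] ->; last first.
    by rewrite eqxx (negbTE (max_notin _)).
  by rewrite (mem_imset _ _ lift_inj) inE eq_sym neq_lift.
rewrite (bigID (fun W : {set 'I_n.+1} => ord_max \notin W)) /=; congr (_ + _).
  rewrite (reindex_onto (fun W : {set 'I_n} => lift ord_max @: W)
                        (fun W => lift ord_max @^-1: W)) => [|W].
    by apply: eq_bigl => W; rewrite imsetK eqxx max_notin !andbT.
  case/andP => _ notin_W; rewrite preimsetK; apply/setP => i; rewrite !inE.
  by case: eqVneq => // ->; rewrite (negbTE notin_W).
rewrite (reindex_onto (fun W : {set 'I_n} => ord_max |: lift ord_max @: W)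
                      (fun W => lift ord_max @^-1: W)) => [|W].
  by apply: eq_bigl => W; rewrite setU1K eqxx setU11 !andbT.
by case/andP => _; rewrite negbK => in_W; rewrite preimsetK setD1K.
Qed.

(** These are the sets to which a dominating vertex can be added: the empty set contributes 1 and
    each singleton contributes ['X]. *)
Lemma sum_card_le1 (R : nzRingType) (T : finType) :
  \sum_(W : {set T} | (#|W| <= 1)%N) 'X^#|W| = 1 + #|T|%:R * 'X :> {poly R}.
Proof.
rewrite (bigD1 set0) ?cards0 //=; congr (_ + _).
rewrite (eq_bigl [in [set W : {set T} | #|W| == 1%N]]) => [|W]; last first.
  by rewrite inE -cards_eq0; case: #|W| => [|[]].
rewrite (eq_bigr (fun=> 'X)) => [|W]; last by rewrite inE => /eqP ->.
by rewrite sumr_const card_draws bin1 mulr_natl.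
Qed.

Lemma indep_poly_rcons (n : nat) (b : n.-tuple bool) (c : bool) :
  indep_poly (string_hypergraph [tuple of rcons b c]) =
  indep_poly (string_hypergraph b) +
  'X * if c then 1 + n%:R * 'X else indep_poly (string_hypergraph b).
Proof.
have card_lift (W : {set 'I_n}) : #|lift ord_max @: W| = #|W|.
  exact/card_imset/lift_inj.
have card_max (W : {set 'I_n}) : #|ord_max |: lift ord_max @: W| = #|W|.+1.
  rewrite cardsU1 card_lift; case: imsetP => // -[i _ /eqP].
  by rewrite (negbTE (neq_lift _ _)).
rewrite {1}/indep_poly big_set_ord_recr; congr (_ + _).
  by apply: eq_big => W; rewrite ?string_independent_lift ?card_lift.
under eq_bigl => W do rewrite string_independent_max.
under eq_bigr => W do rewrite card_max exprS.
by rewrite -mulr_sumr; case: c; rewrite ?sum_card_le1 ?card_ord.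
Qed.

(** The case split on short lengths is harmless, since at most two vertices leave no room for a
    3-set. *)
Lemma antiregularE (n : nat) (c : bool) :
  antiregular n c = string_hypergraph (antiregular_string n c).
Proof.
rewrite /antiregular; case: leqP => // n2; apply/esym/setP => e; rewrite !inE.
apply/negP => /andP[/eqP card_e _].
by have := max_card [in e]; rewrite card_e card_ord leqNgt ltnS n2.
Qed.

(** For [n] below 2 the two strings may differ in their last bit, so only the hypergraphs are
    equated. *)
Lemma antiregular_rcons (n : nat) (c : bool) :
  antiregular n.+1 c =
  string_hypergraph [tuple of rcons (antiregular_string n (~~ c)) c].
Proof.
rewrite antiregularE; apply: eq_string_hypergraph => i.
rewrite tnth_mktuple; case: (unliftP ord_max i) => [k|] -> i2.
  (* Appending a vertex raises the distance to the last index by one, and negating [c] compensates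
     for the change of parity. *)
  rewrite tnth_rcons_lift tnth_mktuple; rewrite lift_max in i2 *.
  by rewrite i2 subSS -(subnSK (ltn_ord k)) /= addbN addNb.
by rewrite tnth_rcons_max i2 /= subnn addbF.
Qed.

Lemma indep_poly_antiregular0 (c : bool) : indep_poly (antiregular 0 c) = 1.
Proof.
rewrite /indep_poly (big_pred1 set0) ?cards0 // => W.
have -> : W = set0 by apply/setP => -[].
by rewrite [RHS]eqxx; apply/forall_inP => e; rewrite inE.
Qed.

Lemma indep_poly_Abar_rec (n : nat) :
  indep_poly (Abar n.+1) = (1 + 'X) * indep_poly (A n).
Proof.
by rewrite /Abar antiregular_rcons indep_poly_rcons -antiregularE mulrDl mul1r.
Qed.

Lemma indep_poly_A_rec (n : nat) :
  indep_poly (A n.+1) = indep_poly (Abar n) + 'X * (1 + n%:R * 'X).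
Proof. by rewrite /A antiregular_rcons indep_poly_rcons -antiregularE. Qed.

(** Each recurrence swaps the two families and the parity of the length, so two steps lead from even
    length to the next even length within the same family. *)
Lemma indep_poly_A_double (n : nat) :
  indep_poly (A (2 * n)) =
    (1 + 'X) ^+ n.+1 + 3%:R * (1 + 'X) ^+ n - (2 * n + 1)%:R * 'X - 3%:R
  /\ indep_poly (Abar (2 * n)) =
    3%:R * (1 + 'X) ^+ n.+1 + (1 + 'X) ^+ n
    - (1 + 'X) * ((2 * n)%:R * 'X + 3%:R).
Proof.
elim: n => [|n [IHA IHAbar]].
  by rewrite muln0 /A /Abar !indep_poly_antiregular0; split; ring.
rewrite mulnS !addSn add0n !(indep_poly_A_rec, indep_poly_Abar_rec) IHA IHAbar.
by rewrite !exprS -!natr1 addn1 -!natr1; split; ring.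
Qed.

Theorem theorem2p3 (n : nat) (hn : (1 <= n)%N) :
  [/\ indep_poly (A (2 * n - 1)) =
        3%:R * (1 + 'X) ^+ n + (1 + 'X) ^+ (n - 1) - (2 * n)%:R * 'X - 3%:R,
      indep_poly (Abar (2 * n)) =
        3%:R * (1 + 'X) ^+ n.+1 + (1 + 'X) ^+ n
        - (1 + 'X) * ((2 * n)%:R * 'X + 3%:R),
      indep_poly (Abar (2 * n - 1)) =
        (1 + 'X) ^+ n.+1 + 3%:R * (1 + 'X) ^+ n
        - (1 + 'X) * ((2 * n - 1)%:R * 'X + 3%:R)
    & indep_poly (A (2 * n)) =
        (1 + 'X) ^+ n.+1 + 3%:R * (1 + 'X) ^+ n
        - (2 * n + 1)%:R * 'X - 3%:R].
Proof.
have [defA defAbar] := indep_poly_A_double n; split=> //.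
  (* With [n.+1] for [n], the odd length is [2 * n + 1], one recurrence step after the even length
     [2 * n]; the remaining odd case is treated alike. *)
  case: n hn {defA defAbar} => // n _.
  rewrite mulnS addSn !subSS !subn0 add1n indep_poly_A_rec.
  by rewrite (indep_poly_A_double n).2 !exprS -!natr1; ring.
case: n hn {defA defAbar} => // n _.
rewrite mulnS addSn !subSS !subn0 add1n indep_poly_Abar_rec.
by rewrite (indep_poly_A_double n).1 addn1 !exprS -!natr1; ring.
Qed.
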